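(* Let $p\ge 3$ be a prime and $r$ a positive integer. Then \[\sum_{\substack{i+j+k=p^{r}\\ i,j,k\in \mathcal{P}_{p}}}\frac{(-1)^{i}}{ijk}\equiv \frac{p^{r-1}}{2}B_{p-3}\pmod{p^{r}},\] where the sum runs over all ordered triples $(i,j,k)$ of positive integers, each prime to $p$, with $i+j+k=p^r$.
   Context: $\mathcal{P}_{p}$ denotes the set of positive integers that are prime to $p$. $B_n$ denotes the $n$-th Bernoulli number, defined by $\frac{x}{e^x-1}=\sum_{n\ge 0}\frac{B_n}{n!}x^n$. Congruences between rational numbers whose denominators are prime to $p$ are understood in the ring of $p$-integral rationals $\mathbb{Z}_{(p)}$, i.e. $a\equiv b \pmod{p^r}$ means $(a-b)/p^r$ is a rational number with denominator prime to $p$. *)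

(* Defs.v *)
From mathcomp Require Import all_boot all_order all_algebra.
Set Implicit Arguments.
Unset Strict Implicit.
Unset Printing Implicit Defensive.
Import Order.TTheory GRing.Theory Num.Theory.
Local Open Scope ring_scope.

(* Coefficients of the inverse of the formal power series
   (e^x - 1) / x = \sum_n x^n / (n+1)!, computed as a growing list. *)
Fixpoint bernoulli_egf_seq (n : nat) : seq rat :=
  if n is m.+1 then
    let s := bernoulli_egf_seq m in
    rcons s ((m == 0%N)%:R - \sum_(i < m) s`_i / ((m - i).+1)`!%:R)
  else [::].

Definition bernoulli (n : nat) : rat := n`!%:R * (bernoulli_egf_seq n.+1)`_n.

Definition expm1_coef (n : nat) : rat := if n is 0 then 0 else n`!%:R^-1.

Lemma size_bernoulli_egf_seq n : size (bernoulli_egf_seq n) = n.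
Proof. by elim: n => //= n IHn; rewrite size_rcons IHn. Qed.

Lemma nth_bernoulli_egf_seq m n : (m < n)%N ->
  (bernoulli_egf_seq n)`_m = bernoulli m / m`!%:R.
Proof.
have f0 : m`!%:R != 0 :> rat by rewrite pnatr_eq0 -lt0n fact_gt0.
rewrite /bernoulli mulrAC divff // mul1r.
elim: n => // n IHn; rewrite ltnS leq_eqVlt => /orP[/eqP-> //|lt_mn].
by rewrite [LHS]/= nth_rcons size_bernoulli_egf_seq lt_mn IHn.
Qed.

(* x = (e^x - 1) * \sum_n B_n / n! x^n, coefficient by coefficient. *)
Lemma bernoulli_gf (n : nat) :
  \sum_(i < n.+1) expm1_coef (n - i) * (bernoulli i / i`!%:R) = (n == 1%N)%:R.
Proof.
case: n => [|n]; first by rewrite big_ord1 mul0r.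
rewrite big_ord_recr /= subnn mul0r addr0 big_ord_recr /= subSnn /= mul1r.
rewrite -[X in _ + X = _](@nth_bernoulli_egf_seq n n.+1) //= nth_rcons.
rewrite size_bernoulli_egf_seq ltnn eqxx eqSS addrC.
rewrite -[RHS]addr0 -addrA; congr (_ + _); rewrite addrC; apply/eqP.
rewrite subr_eq0; apply/eqP; apply: eq_bigr => i _.
by rewrite nth_bernoulli_egf_seq // subSn 1?ltnW // mulrC.
Qed.

Definition prime_to (p : nat) : pred nat :=
  fun n => (0 < n)%N && coprime n p.

Definition p_integral (p : nat) (a : rat) : bool := coprime `|denq a|%N p.

Definition congr_mod (p r : nat) (a b : rat) : bool :=
  p_integral p ((a - b) / p%:R ^+ r).

(* Main.v *)
(* Put [q = p ^ r] and work in [Z/q].  Replacing [(i, j, k)] by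
   [(q - i, q - j, q - k)] leaves the summand unchanged modulo [q] and exchanges
   the triples of sum [q] with those of sum [2q], so twice the sum runs over all
   triples of units with [x + y + z = 0].  Scaling [y] and [z] by [x] factors it
   as [\sum_x (-1)^x x^-3] times [\sum_(1 + y + z = 0) 1 / (y z)].  The latter is
   [-2 \sum 1/y] over the units [y] with [1 + y] a unit, which is [-2 p^(r-1)].
   Since the summand of the former changes sign under [x -> x + p] modulo [p],
   it remains to show [\sum_(b < p) (-1)^b b^-3 = - B_(p-3) / 2] modulo [p].
   By Fermat the left side is an alternating power sum; those satisfy modulo [p]
   the recurrence of the coefficients of [2 / (e^x + 1)]. *)
From HB Require Import structures.
Require Import Defs.
From mathcomp Require Import all_boot all_order all_algebra ring zify.
Import Order.TTheory GRing.Theory Num.Theory.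
Local Open Scope ring_scope.
Set Implicit Arguments.
Unset Strict Implicit.
Unset Printing Implicit Defensive.

(** * Rationals with denominator prime to p, and their reduction *)

(** A collective predicate, so that [p_integral] can carry a subring structure and the [rpred]
    lemmas apply. *)
Definition Zloc (p : nat) : {pred rat} := [pred x | p_integral p x].

(** The fraction need not be reduced: by Gauss, its reduced denominator divides [d]. *)
Lemma Zloc_frac p (n d : int) : d != 0 -> coprime `|d|%N p ->
  n%:~R / d%:~R \in Zloc p.
Proof.
move=> d0 dp; rewrite inE /p_integral; set x := _ / _.
apply: coprime_dvdl dp.
have eqx : numq x * d = n * denq x.
  apply: (@intr_inj rat); rewrite !rmorphM /= numqE /x.
  by field; rewrite intr_eq0.
have h : (`|denq x| %| `|numq x| * `|d|)%N by rewrite -abszM eqx abszM dvdn_mull.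
by rewrite Gauss_dvdr // coprime_sym coprime_num_den in h.
Qed.

Lemma Zloc_subring_closed p : subring_closed (Zloc p).
Proof.
have E (x : rat) : x = (numq x)%:~R / (denq x)%:~R by rewrite divq_num_den.
have D (x : rat) : (denq x)%:~R != 0 :> rat by rewrite intr_eq0 denq_eq0.
split=> [|x y xp yp|x y xp yp].
- by have := @Zloc_frac p 1 1 isT (coprime1n _); rewrite divr1.
- have -> : x - y = (numq x * denq y - numq y * denq x)%:~R
               / (denq x * denq y)%:~R.
    rewrite [in LHS](E x) [in LHS](E y) rmorphB /= !rmorphM /=.
    by field; rewrite !D.
  by apply: Zloc_frac; rewrite ?mulf_neq0 ?denq_eq0 // abszM coprimeMl; apply/andP.
- have -> : x * y = (numq x * numq y)%:~R / (denq x * denq y)%:~R.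
    by rewrite [in LHS](E x) [in LHS](E y) !rmorphM /=; field; rewrite !D.
  by apply: Zloc_frac; rewrite ?mulf_neq0 ?denq_eq0 // abszM coprimeMl; apply/andP.
Qed.

HB.instance Definition _ p :=
  GRing.isSubringClosed.Build rat (Zloc p) (@Zloc_subring_closed p).

Lemma Zloc_invn p d : coprime d p -> d%:R^-1 \in Zloc p.
Proof.
case: d => [|d] dp; first by rewrite invr0 rpred0.
by have := @Zloc_frac p 1 d.+1 isT dp; rewrite mul1r.
Qed.

Section Reduction.

Variables (p r : nat).
Hypotheses (p_prime : prime p) (r_gt0 : (0 < r)%N).
Let q := (p ^ r)%N.
Let Zq := 'Z_(p ^ r).

Lemma pexp_gt1 : (1 < q)%N.
Proof. exact: leq_ltn_trans r_gt0 (ltn_expl r (prime_gt1 p_prime)). Qed.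

Lemma unit_natZq n : (n%:R \is a @GRing.unit Zq) = coprime n p.
Proof. by rewrite unitZpE ?pexp_gt1 // coprime_pexpl // coprime_sym. Qed.

Lemma natZq_eq0 n : (n%:R == 0 :> Zq) = (q %| n)%N.
Proof.
have := pexp_gt1; rewrite -/q => q1.
rewrite /dvdn -(inj_eq val_inj) /= val_Zp_nat //.
Qed.

Lemma unit_intZq (z : int) : (z%:~R \is a @GRing.unit Zq) = coprime `|z|%N p.
Proof.
rewrite [X in X%:~R]intEsign rmorphM /= rmorph_sign unitrMr.
  by rewrite -unit_natZq.
by rewrite unitrX // unitrN1.
Qed.

Lemma intZq_eq0 (z : int) : (z%:~R == 0 :> Zq) = (q %| `|z|)%N.
Proof.
rewrite [X in X%:~R]intEsign rmorphM /= rmorph_sign.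
by rewrite -natZq_eq0 mulrI_eq0 //; apply: lreg_sign.
Qed.

(** [Zq] is not a field in general, so [ratr] is a morphism only on [Zloc p], where [denq x] becomes
    a unit. This lemma lets any integer relation for [x] compute [ratr x]; the morphism laws follow
    from it. *)
Lemma ratr_Zloc (x : rat) (n d : int) : x \in Zloc p -> x * d%:~R = n%:~R ->
  ratr x * d%:~R = n%:~R :> Zq.
Proof.
move=> xp eqx; have eqz : numq x * d = n * denq x.
  apply: (@intr_inj rat); rewrite !rmorphM /= -eqx numqE; ring.
have u : (denq x)%:~R \is a @GRing.unit Zq by rewrite unit_intZq.
apply: (mulIr u); by rewrite /ratr mulrAC divrK // -!rmorphM eqz.
Qed.

Lemma ratr_ZlocD : {in Zloc p &, {morph (ratr : rat -> Zq) : x y / x + y}}.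
Proof.
move=> x y xp yp; have u : (denq x)%:~R * (denq y)%:~R \is a @GRing.unit Zq.
  by rewrite unitrM !unit_intZq; apply/andP.
have E (z : rat) : z * (denq z)%:~R = (numq z)%:~R by rewrite numqE.
apply: (mulIr u); rewrite -rmorphM /=.
rewrite (@ratr_Zloc _ (numq x * denq y + numq y * denq x)) ?rpredD //.
  rewrite mulrDl rmorphM mulrA (ratr_Zloc xp (E x)) rmorphD !rmorphM /=.
  by rewrite mulrCA (ratr_Zloc yp (E y)) [X in _ + X]mulrC.
by rewrite mulrDl rmorphD !rmorphM /= -!E; ring.
Qed.

Lemma ratr_ZlocM : {in Zloc p &, {morph (ratr : rat -> Zq) : x y / x * y}}.
Proof.
move=> x y xp yp; have u : (denq x)%:~R * (denq y)%:~R \is a @GRing.unit Zq.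
  by rewrite unitrM !unit_intZq; apply/andP.
have E (z : rat) : z * (denq z)%:~R = (numq z)%:~R by rewrite numqE.
apply: (mulIr u); rewrite -{1}rmorphM /=.
rewrite (@ratr_Zloc _ (numq x * numq y)) ?rpredM //.
  by rewrite mulrACA (ratr_Zloc xp (E x)) (ratr_Zloc yp (E y)) rmorphM.
by rewrite !rmorphM /= -!E; ring.
Qed.

Lemma ratr_natZq n : ratr n%:R = n%:R :> Zq.
Proof.
by have := @ratr_Zloc n%:R n 1 (rpred_nat _ n); rewrite !mulr1; apply.
Qed.

Lemma ratr_ZlocN : {in Zloc p, {morph (ratr : rat -> Zq) : x / - x}}.
Proof.
move=> x xp; apply/eqP; rewrite -addr_eq0 -ratr_ZlocD ?rpredN // addNr.
by rewrite (ratr_natZq 0).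
Qed.

Lemma ratr_sum_Zloc I (s : seq I) (P : pred I) (F : I -> rat) :
  (forall i, P i -> F i \in Zloc p) ->
  ratr (\sum_(i <- s | P i) F i) = \sum_(i <- s | P i) ratr (F i) :> Zq.
Proof.
(* Additivity of [ratr] holds only on [Zloc p], so the induction carries membership along. *)
move=> Fp; pose K (x : rat) (y : Zq) := x \in Zloc p /\ ratr x = y.
suff [] : K (\sum_(i <- s | P i) F i) (\sum_(i <- s | P i) ratr (F i)) by [].
apply: big_rec2 => [|i y x Pi [xp <-]]; first by split; rewrite ?rpred0 ?(ratr_natZq 0).
by split; rewrite ?rpredD ?Fp // ratr_ZlocD ?Fp.
Qed.

Lemma ratr_invnZq d : coprime d p -> ratr (d%:R^-1) = d%:R^-1 :> Zq.
Proof.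
move=> dp; have d0 : d%:R != 0 :> rat.
  by rewrite pnatr_eq0; apply: contraTneq dp => ->; rewrite /coprime gcd0n neq_ltn prime_gt1 ?orbT.
have u : d%:R \is a @GRing.unit Zq by rewrite unit_natZq.
apply: (mulIr u); rewrite mulVr //.
by apply: (@ratr_Zloc _ 1 d); rewrite ?Zloc_invn // mulVf.
Qed.

(** If [a - b] reduces to [0], then [q] divides its numerator, and the quotient by [p ^ r] keeps the
    denominator of [a - b]. *)
Lemma congr_mod_ratr a b : a \in Zloc p -> b \in Zloc p ->
  ratr a = ratr b :> Zq -> congr_mod p r a b.
Proof.
move=> ap bp eqab; have abp : a - b \in Zloc p by rewrite rpredB.
have p0 : p%:R != 0 :> rat by rewrite pnatr_eq0 -lt0n prime_gt0.
have : ratr (a - b) = 0 :> Zq by rewrite ratr_ZlocD ?rpredN // ratr_ZlocN // eqab subrr.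
have u : (denq (a - b))%:~R \is a @GRing.unit Zq by rewrite unit_intZq.
move=> z; have := @ratr_Zloc (a - b) (numq (a - b)) (denq (a - b)) abp.
rewrite z mul0r numqE => /(_ erefl) /esym /eqP; rewrite intZq_eq0.
rewrite -(@dvdzE (Posz q)) => /dvdzP [m eqm]; rewrite /congr_mod.
have -> : (a - b) / p%:R ^+ r = m%:~R / (denq (a - b))%:~R.
  rewrite -{1}(divq_num_den (a - b)) eqm rmorphM /= -!pmulrn natrX.
  by field; rewrite intr_eq0 denq_eq0 expf_neq0.
by apply: Zloc_frac => //; rewrite denq_eq0.
Qed.

Lemma congr_mod_trans a b c :
  congr_mod p r a b -> congr_mod p r b c -> congr_mod p r a c.
Proof.
rewrite /congr_mod => h1 h2.
have -> : (a - c) / p%:R ^+ r = (a - b) / p%:R ^+ r + (b - c) / p%:R ^+ r.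
  by rewrite -mulrDl addrA subrK.
by apply: (@rpredD _ (Zloc p)).
Qed.

End Reduction.

(** * The triple sum in Z/q *)

(** Consecutive blocks of length [p] have opposite sums, so they cancel in pairs. *)
Lemma sum_antiperiodic (R : pzRingType) (f : nat -> R) p m :
  (forall i, f (i + p)%N = - f i) ->
  \sum_(i < m * p) f i = (odd m)%:R * \sum_(i < p) f i.
Proof.
move=> fp; have E k i : f (k * p + i)%N = (-1) ^+ k * f i.
  elim: k => [|k IHk]; first by rewrite mul1r.
  by rewrite mulSn -addnA addnC fp IHk exprS mulN1r mulNr.
elim: m => [|m IHm]; first by rewrite big_ord0 mul0r.
rewrite mulSn addnC big_split_ord /= IHm.
under [X in _ + X]eq_bigr do rewrite E.
rewrite -mulr_sumr -mulrDl -signr_odd; congr (_ * _).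
by case: (odd m); rewrite ?addr0 ?add0r ?expr1 ?subrr.
Qed.

(** The elements of [Zq] are ordinals below [(Zp_trunc q).+2], which equals [q] only
    propositionally. *)
Lemma sum_ord_cast (R : nmodType) (f : nat -> R) m n : m = n ->
  \sum_(i < m) f i = \sum_(i < n) f i.
Proof. by move->. Qed.

Section TripleSum.

Variables (p r : nat).
Hypotheses (p_prime : prime p) (p_odd : odd p) (r_gt0 : (0 < r)%N).
Let q := (p ^ r)%N.
Let Zq := 'Z_(p ^ r).
Implicit Types x y z : Zq.

Let q_gt1 : (1 < q)%N := pexp_gt1 p_prime r_gt0.
Let q_cast : (Zp_trunc q).+2 = q := Zp_cast q_gt1.

Local Notation U := (@GRing.unit Zq).

Lemma unitZq_val x : (x \is a GRing.unit) = coprime x p.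
Proof. by rewrite -(unit_natZq p_prime r_gt0) natr_Zp. Qed.

Lemma unit2Zq : 2%:R \is a U.
Proof. by rewrite unit_natZq // coprime2n. Qed.

Lemma unitZq_val_gt0 x : x \is a U -> (0 < x)%N.
Proof.
rewrite unitZq_val; apply: contraTT; rewrite -leqNgt leqn0 => /eqP ->.
by rewrite /coprime gcd0n neq_ltn prime_gt1 ?orbT.
Qed.

Lemma prime_to_Zq x : prime_to p x = (x \is a U).
Proof.
rewrite /prime_to -unitZq_val; case: (boolP (_ \is a U)); rewrite ?andbF // andbT.
exact: unitZq_val_gt0.
Qed.

Lemma odd_pexp m : odd (p ^ m)%N.
Proof. by rewrite oddX p_odd orbT. Qed.

Lemma ltn_Zq x : (x < q)%N.
Proof. by rewrite -[X in (_ < X)%N]q_cast ltn_ord. Qed.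

Lemma val_oppZq x : x \is a U -> (- x : Zq) = (q - x)%N :> nat.
Proof.
move=> /unitZq_val_gt0; have := ltn_Zq x; rewrite [LHS]/=.
move: (nat_of_ord x) => a; rewrite q_cast => lt_aq a_gt0.
by rewrite modn_small //; lia.
Qed.

(** The sign is read on the representative in [[0, q)]; as [q] is odd, [x] and [q - x] have opposite
    parity. *)
Lemma oppZq_sign x : x \is a U -> (-1) ^+ (- x : Zq) = - (-1) ^+ x :> Zq.
Proof.
move=> xu; rewrite (val_oppZq xu) -signr_odd oddB.
  rewrite odd_pexp -(signr_odd _ x); case: (odd x); rewrite ?expr1 ?opprK //.
by rewrite ltnW // ltn_Zq.
Qed.

Lemma sumZq_odd (P : pred Zq) (F : Zq -> Zq) :
  (forall x, P (- x) = P x) -> (forall x, P x -> F (- x) = - F x) ->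
  \sum_(x | P x) F x = 0.
Proof.
move=> Pn Fn; set s := (LHS).
have sN : s = - s.
  rewrite {1}/s (reindex_inj oppr_inj) /= -sumrN.
  by apply: eq_big => x; rewrite Pn // => /Fn.
apply: (mulrI unit2Zq); rewrite mulr0 mulr_natl mulr2n {2}sN subrr //.
Qed.

Lemma sum_ord_Zq (F : nat -> Zq) : F q = 0 -> \sum_(i < q.+1) F i = \sum_(x : Zq) F x.
Proof.
by move=> Fq; rewrite big_ord_recr /= Fq addr0; apply: sum_ord_cast; rewrite q_cast.
Qed.

(** There are [q - totient q = p ^ r.-1] non-units. *)
Lemma sum_nonunit1 : \sum_(x : Zq | x \isn't a U) 1 = (p ^ r.-1)%:R :> Zq.
Proof.
have q0 : q%:R = 0 :> Zq by apply/eqP; rewrite natZq_eq0.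
have: \sum_(x : Zq) 1 = 0 :> Zq by rewrite sumr_const card_ord q_cast.
rewrite (bigID (mem U)) /= => /eqP; rewrite addrC addr_eq0 => /eqP ->.
rewrite big_mkcond /=.
under eq_bigr => x _.
  rewrite unitZq_val coprime_sym -(@coprime_pexpl r) //.
  rewrite (_ : (if _ then _ else _) = (coprime q x)%:R); last by case: coprime.
  over.
rewrite -natr_sum /= (_ : \sum_(i : Zq) _ = totient q)%N; last first.
  rewrite totient_count_coprime big_mkord.
  exact: (@sum_ord_cast nat (fun d => nat_of_bool (coprime q d))).
apply/eqP; rewrite totient_pfactor // eq_sym -addr_eq0 -natrD -mulSn.
by rewrite prednK ?prime_gt0 // -expnS prednK // -/q q0.
Qed.

Lemma nonunitD1_unit x : 1 + x \isn't a U -> x \is a U.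
Proof.
rewrite -(natr_Zp x) -(natrD _ 1%N) !unit_natZq // !(coprime_sym _ p).
rewrite !prime_coprime // negbK; apply: contraTN => px.
by rewrite dvdn_addl // dvdn1 neq_ltn prime_gt1 ?orbT.
Qed.

(** The sum of [x^-1] over all units is [0] by oddness, so it suffices to treat the [x] with [1 + x]
    not a unit. Inversion preserves this set, and the shift by [-1] turns the sum into that of
    [x - 1] over the non-units [x], whose linear part vanishes by oddness. *)
Lemma sum_inv_unitD1 :
  \sum_(x | (x \is a U) && (1 + x \is a U)) x^-1 = (p ^ r.-1)%:R :> Zq.
Proof.
have : \sum_(x : Zq | x \is a U) x^-1 = 0.
  by apply: sumZq_odd => x; rewrite ?unitrN // invrN.
rewrite (bigID (fun x => 1 + x \is a U)) /= => /eqP.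
rewrite addr_eq0 => /eqP ->.
rewrite (reindex_inj (inv_inj (@invrK Zq))) /=.
rewrite (eq_bigl (fun x => 1 + x \isn't a U)); last first.
  move=> x; rewrite unitrV; case: (boolP (x \is a U)) => /= [xu|xnu].
    by rewrite -[in LHS](unitrMl _ xu) mulrDl mul1r mulVr // addrC.
  by apply/esym/negbTE; rewrite negbK; apply: contraR xnu => /nonunitD1_unit.
under eq_bigr do rewrite invrK.
rewrite (reindex_inj (addrI (-1))) /= -sum_nonunit1.
rewrite (eq_bigl (fun x => x \isn't a U)); last by move=> x; rewrite addrA subrr add0r.
rewrite big_split /= [X in _ + X]sumZq_odd; [|by move=> x; rewrite unitrN|by []].
by rewrite addr0 sumrN opprK.
Qed.

Lemma sum_inv_pairs :
  \sum_(y : Zq) \sum_(z : Zq) (if [&& y \is a U, z \is a U & 1 + y + z == 0]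
                 then y^-1 * z^-1 else 0) = - 2%:R * (p ^ r.-1)%:R :> Zq.
Proof.
pose C y z := [&& y \is a U, z \is a U & 1 + y + z == 0].
pose F y z := if C y z then y^-1 else 0.
have E : \sum_y \sum_z F y z = (p ^ r.-1)%:R.
  rewrite -sum_inv_unitD1 [RHS]big_mkcond; apply: eq_bigr => y _.
  (* Given [y], the only admissible [z] is [- (1 + y)]. *)
  rewrite (bigD1 (- (1 + y))) //= big1 ?addr0 => [|z zy].
    by rewrite /F /C subrr eqxx andbT unitrN.
  by rewrite /F /C addrC addr_eq0 (negbTE zy) !andbF.
(* Partial fractions: [y + z = -1] gives [1 / (y z) = - 1 / y - 1 / z], and the two halves agree by
   symmetry. *)
transitivity (\sum_y \sum_z (- F y z - F z y)).
  apply: eq_bigr => y _; apply: eq_bigr => z _.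
  rewrite /F /C -!(addrA 1) (addrC z) (andbCA (z \is a U) (y \is a U)).
  case: and3P => [[yu zu /eqP yz]|]; last by rewrite subr0 oppr0.
  apply: (mulrI yu); apply: (mulIr zu).
  rewrite mulrA divrr // mul1r mulVr // mulrBr !mulrN divrr // mulrBl mulN1r.
  rewrite mulrVK //; apply/eqP; rewrite -subr_eq0 -yz; apply/eqP; ring.
under eq_bigr do rewrite big_split sumrN /=.
rewrite big_split sumrN /= E; under eq_bigr do rewrite sumrN.
by rewrite sumrN exchange_big /= E mulNr mulr_natl mulr2n opprD.
Qed.

Let W x y z : Zq := (-1) ^+ x * (x * y * z)^-1.

Lemma sumZq_addN (F G : Zq -> Zq) :
  \sum_x F x + \sum_x G x = \sum_x (F x + G (- x)).
Proof. by rewrite [X in _ + X](reindex_inj oppr_inj) -big_split. Qed.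

Lemma sum_triples_eq0 :
  2%:R * \sum_x \sum_y \sum_z
    (if [&& x \is a U, y \is a U, z \is a U & (x + y + z == q)%N]
     then W x y z else 0)
  = \sum_x \sum_y \sum_z
    (if [&& x \is a U, y \is a U, z \is a U & x + y + z == 0]
     then W x y z else 0).
Proof.
rewrite mulr_natl mulr2n.
rewrite sumZq_addN; apply: eq_bigr => x _.
rewrite sumZq_addN; apply: eq_bigr => y _.
rewrite sumZq_addN; apply: eq_bigr => z _.
rewrite /= !unitrN.
case: (boolP (x \is a U)) => /= xu; last by rewrite addr0.
case: (boolP (y \is a U)) => /= yu; last by rewrite addr0.
case: (boolP (z \is a U)) => /= zu; last by rewrite addr0.
have -> : W (- x) (- y) (- z) = W x y z.
  by rewrite /W oppZq_sign // !mulrNN mulrN invrN mulrNN.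
have := (val_oppZq xu, val_oppZq yu, val_oppZq zu).
rewrite /= => -[[-> ->] ->].
have -> : (x + y + z == 0) = (q %| x + y + z)%N.
  by rewrite -natZq_eq0 // !natrD !natr_Zp.
have := (unitZq_val_gt0 xu, unitZq_val_gt0 yu, unitZq_val_gt0 zu).
(* The representatives lie strictly between [0] and [q], so a multiple of [q] that is their sum is
   [q] or [2q]. The first copy of the sum accounts for [q], the opposed copy for [2q]. *)
move: (ltn_Zq x) (ltn_Zq y) (ltn_Zq z).
move: (x : nat) (y : nat) (z : nat) (W x y z) => a b c w ha hb hc [[a0 b0] c0].
have [h1|h1] := altP (a + b + c =P q)%N.
  by rewrite h1 dvdnn ifF ?addr0 //; lia.
have [h2|h2] := altP (a + b + c =P 2 * q)%N.
  by rewrite h2 dvdn_mull // ifT ?add0r //; lia.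
rewrite ifF; last by lia.
rewrite ifF ?addr0 //; apply/negP => /dvdnP [k hk].
have : (0 < k < 3)%N by apply/andP; split; nia.
by case: k hk => [|[|[|k]]] // hk _; lia.
Qed.

Lemma sum_triples_eq0E :
  \sum_x \sum_y \sum_z
    (if [&& x \is a U, y \is a U, z \is a U & x + y + z == 0]
     then W x y z else 0)
  = - 2%:R * (p ^ r.-1)%:R * \sum_(x | x \is a U) (-1) ^+ x * x^-1 ^+ 3.
Proof.
rewrite -sum_inv_pairs mulr_sumr [RHS]big_mkcond; apply: eq_bigr => x _.
case: ifP => xu; last by rewrite big1 // => y _; rewrite big1.
rewrite (reindex_inj (mulrI xu)) mulr_suml; apply: eq_bigr => y _.
rewrite (reindex_inj (mulrI xu)) mulr_suml; apply: eq_bigr => z _.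
rewrite /= !unitrMr // -{1}[x]mulr1 -!mulrDr mulrI_eq0; last exact: mulrI.
case: ifP => [/and3P[yu zu _]|]; last by rewrite mul0r.
rewrite /W !invrM ?unitrM ?xu ?yu ?zu //; ring.
Qed.

Lemma sum_triplesE :
  \sum_x \sum_y \sum_z
    (if [&& x \is a U, y \is a U, z \is a U & (x + y + z == q)%N]
     then W x y z else 0)
  = - (p ^ r.-1)%:R * \sum_(x | x \is a U) (-1) ^+ x * x^-1 ^+ 3.
Proof.
apply: (mulrI unit2Zq); rewrite sum_triples_eq0 sum_triples_eq0E; ring.
Qed.

End TripleSum.

(** Used with [c = p ^ r.-1]: multiplication by it turns congruence modulo [p] into equality in
    [Z/q], and inverse powers respect this. *)
Lemma eq_mul_invX (R : comUnitRingType) (c a b : R) n :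
  a \is a GRing.unit -> b \is a GRing.unit -> c * a = c * b ->
  c * a^-1 ^+ n = c * b^-1 ^+ n.
Proof.
move=> au bu cab; have cV : c * a^-1 = c * b^-1.
  by apply: (mulIr au); rewrite divrK // mulrAC cab mulrK.
elim: n => [|n IHn]; first by rewrite !expr0.
by rewrite !exprS mulrA cV mulrAC IHn -mulrA [_ * b^-1]mulrC.
Qed.

(** The term [b = 0] vanishes, because the inverse of [0] is [0]. *)
Definition alt_inv_cubes (p : nat) : rat := \sum_(b < p) (-1) ^+ b / b%:R ^+ 3.

(** * From units modulo [q] to residues modulo [p] *)

Section TripleSumModPrimePower.

Variables (p r : nat).
Hypotheses (p_prime : prime p) (p_odd : odd p) (r_gt0 : (0 < r)%N).
Let q := (p ^ r)%N.
Let Zq := 'Z_(p ^ r).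
Local Notation U := (@GRing.unit Zq).

Lemma sign_Zloc i : (-1) ^+ i \in Zloc p.
Proof. by rewrite rpredX // rpredN rpred1. Qed.

Lemma ratr_sign_inv i m : coprime m p ->
  ratr ((-1) ^+ i / m%:R) = (-1) ^+ i * m%:R^-1 :> Zq.
Proof.
move=> mp; rewrite ratr_ZlocM ?sign_Zloc ?Zloc_invn // ratr_invnZq //.
congr (_ * _); rewrite -signr_odd -(signr_odd _ i); case: (odd i).
  by rewrite !expr1 ratr_ZlocN ?rpred1 // (ratr_natZq p_prime r_gt0 1).
by rewrite !expr0 (ratr_natZq p_prime r_gt0 1).
Qed.

Lemma coprime_ltn b : (0 < b < p)%N -> coprime b p.
Proof.
by case/andP=> b0 bp; rewrite coprime_sym prime_coprime // gtnNdvd.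
Qed.

Lemma inv_cube_Zloc b : (b < p)%N -> (-1) ^+ b / b%:R ^+ 3 \in Zloc p.
Proof.
case: b => [|b] bp; first by rewrite expr0n invr0 mulr0 rpred0.
rewrite rpredM ?sign_Zloc // -natrX Zloc_invn // coprimeXl //.
exact: coprime_ltn.
Qed.

Lemma alt_inv_cubes_Zloc : alt_inv_cubes p \in Zloc p.
Proof. by apply: rpred_sum => b _; apply: inv_cube_Zloc. Qed.

(** With the factor [p ^ r.-1] the summand is antiperiodic of period [p]. The range consists of
    [p ^ r.-1] blocks, an odd number, so one block survives. *)
Lemma sum_sign_inv_cubes :
  (p ^ r.-1)%:R * \sum_(x : Zq | x \is a U) (-1) ^+ x * x^-1 ^+ 3
  = ratr (p%:R ^+ r.-1 * alt_inv_cubes p).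
Proof.
pose f i : Zq :=
  if coprime i p then (p ^ r.-1)%:R * ((-1) ^+ i * i%:R^-1 ^+ 3) else 0.
have cp i : coprime (i + p) p = coprime i p.
  by rewrite !(coprime_sym _ p) /coprime gcdnDr.
have fp i : f (i + p)%N = - f i.
  rewrite /f cp.
  case: ifP => [ip|_]; last by rewrite oppr0.
  rewrite exprD -(signr_odd _ p) p_odd expr1 mulrN1 mulNr mulrN.
  congr (- _); rewrite !(mulrCA _ ((-1) ^+ i)); congr (_ * _).
  apply: eq_mul_invX.
  - by rewrite unit_natZq // cp.
  - by rewrite unit_natZq.
  rewrite natrD mulrDr -(natrM _ (p ^ r.-1) p) -expnSr prednK //.
  by rewrite (eqP (_ : (p ^ r)%:R == 0 :> Zq)) ?addr0 // natZq_eq0.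
transitivity (\sum_(x : Zq) f x).
  rewrite mulr_sumr big_mkcond; apply: eq_bigr => x _.
  by rewrite /f (unitZq_val p_prime r_gt0) natr_Zp.
transitivity (\sum_(i < p ^ r.-1 * p) f i).
  by apply: sum_ord_cast; rewrite -expnSr prednK // Zp_cast // pexp_gt1.
rewrite sum_antiperiodic // odd_pexp // mul1r.
rewrite ratr_ZlocM ?alt_inv_cubes_Zloc -?natrX ?rpred_nat // ratr_natZq //.
rewrite ratr_sum_Zloc // => [|b _]; last exact: inv_cube_Zloc.
rewrite mulr_sumr; apply: eq_bigr => -[[|b] bp] _ /=.
  rewrite /f expr0n invr0 mulr0 (ratr_natZq p_prime r_gt0 0) mulr0 ifF //.
  by apply/negbTE; rewrite /coprime gcd0n neq_ltn prime_gt1 ?orbT.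
have cbp : coprime b.+1 p by apply: coprime_ltn.
by rewrite /f cbp -(natrX _ b.+1) ratr_sign_inv ?coprimeXl // (natrX _ b.+1) exprVn.
Qed.

Definition triple_sum : rat :=
  \sum_(i < q.+1) \sum_(j < q.+1)
    \sum_(k < q.+1 | [&& prime_to p i, prime_to p j, prime_to p k
                       & (i + j + k == q)%N]) (-1) ^+ i / (i%:R * j%:R * k%:R).

Lemma triple_term_Zloc i j k :
  [&& prime_to p i, prime_to p j, prime_to p k & (i + j + k == q)%N] ->
  (-1) ^+ i / (i%:R * j%:R * k%:R) \in Zloc p.
Proof.
case/and4P=> /andP[_ ip] /andP[_ jp] /andP[_ kp] _.
by rewrite rpredM ?sign_Zloc // -!natrM Zloc_invn // !coprimeMl ip jp.
Qed.

Lemma triple_sum_Zloc : triple_sum \in Zloc p.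
Proof. by do 3!apply: rpred_sum => ? ?; apply: triple_term_Zloc. Qed.

Lemma prime_to_pexpF : prime_to p q = false.
Proof.
rewrite /prime_to coprime_pexpl // /coprime gcdnn andbC.
by rewrite gtn_eqF // prime_gt1.
Qed.

Lemma ratr_triple_sum :
  ratr triple_sum = - ratr (p%:R ^+ r.-1 * alt_inv_cubes p) :> Zq.
Proof.
pose C i j k := [&& prime_to p i, prime_to p j, prime_to p k
                  & (i + j + k == q)%N].
pose F i j k : Zq :=
  if C i j k then (-1) ^+ i * (i%:R * j%:R * k%:R)^-1 else 0.
rewrite -sum_sign_inv_cubes -mulNr -sum_triplesE // /triple_sum.
transitivity (\sum_(i < q.+1) \sum_(j < q.+1) \sum_(k < q.+1) F i j k).
  rewrite ratr_sum_Zloc // => [|i _]; last first.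
    by do 2!apply: rpred_sum => ? ?; apply: triple_term_Zloc.
  apply: eq_bigr => i _; rewrite ratr_sum_Zloc // => [|j _]; last first.
    by apply: rpred_sum => ? ?; apply: triple_term_Zloc.
  apply: eq_bigr => j _; rewrite ratr_sum_Zloc // => [|k]; last first.
    exact: triple_term_Zloc.
  rewrite big_mkcond; apply: eq_bigr => k _; rewrite /F /C.
  case: ifP => // /and4P[/andP[_ ip] /andP[_ jp] /andP[_ kp] _].
  by rewrite -!natrM ratr_sign_inv // !coprimeMl ip jp.
have C0 i j k : ~~ C i j k -> F i j k = 0 by rewrite /F => /negbTE->.
(* The indices go up to [q] inclusive, one more than the elements of [Zq]; the extra terms vanish
   because [q] is not prime to [p]. *)
rewrite (sum_ord_Zq p_prime r_gt0 (F := fun i => \sum_(j < q.+1) \sum_(k < q.+1) F i j k)); last first.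
  by do 2!rewrite big1 // => ? _; rewrite C0 // /C prime_to_pexpF.
apply: eq_bigr => x _.
rewrite (sum_ord_Zq p_prime r_gt0 (F := fun j => \sum_(k < q.+1) F x j k)); last first.
  by rewrite big1 // => ? _; rewrite C0 // /C prime_to_pexpF andbF.
apply: eq_bigr => y _.
rewrite (sum_ord_Zq p_prime r_gt0 (F := F x y)); last first.
  by rewrite C0 // /C prime_to_pexpF !andbF.
by apply: eq_bigr => z _; rewrite /F /C !prime_to_Zq // !natr_Zp.
Qed.

Lemma triple_sum_congr :
  congr_mod p r triple_sum (- (p%:R ^+ r.-1 * alt_inv_cubes p)).
Proof.
have h : p%:R ^+ r.-1 * alt_inv_cubes p \in Zloc p.
  by rewrite -natrX rpredM ?rpred_nat ?alt_inv_cubes_Zloc.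
apply: congr_mod_ratr => //; rewrite ?rpredN ?triple_sum_Zloc //.
by rewrite ratr_ZlocN // ratr_triple_sum.
Qed.

End TripleSumModPrimePower.

(** * Bernoulli numbers and alternating power sums *)

Section LowCoefficients.

Variable R : idomainType.
Implicit Types (P Q : {poly R}) (N : nat).

(** Divisibility by ['X^N]; [low0 N (P - Q)] expresses equality of power series up to order [N]. *)
Definition low0 N P := forall n, (n < N)%N -> P`_n = 0.

Lemma low0D N P Q : low0 N P -> low0 N Q -> low0 N (P + Q).
Proof. by move=> lP lQ n ltnN; rewrite coefD lP // lQ // addr0. Qed.

Lemma low0Ml N P Q : low0 N Q -> low0 N (P * Q).
Proof.
move=> lQ n ltnN; rewrite coefM big1 // => i _.
by rewrite lQ ?mulr0 // (leq_ltn_trans _ ltnN) // leq_subr.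
Qed.

(** [P] has order exactly one, so cancelling it costs one order of precision. *)
Lemma low0_cancel N P Q : P`_0 = 0 -> P`_1 != 0 -> low0 N.+1 (P * Q) ->
  low0 N Q.
Proof.
move=> P0 P1 lPQ; elim/ltn_ind => n IHn ltnN.
have := lPQ n.+1 ltnN; rewrite coefM !big_ord_recl /= P0 mul0r add0r subn1 /=.
rewrite big1 ?addr0 => [/eqP|i _].
  by rewrite mulf_eq0 (negbTE P1) => /eqP.
rewrite IHn ?mulr0 //= /bump /=; have := ltn_ord i; lia.
Qed.

End LowCoefficients.

(** * The coefficients of [2 / (e^x + 1)] *)

Lemma factr_neq0 n : n`!%:R != 0 :> rat.
Proof. by rewrite pnatr_eq0 -lt0n fact_gt0. Qed.

Lemma bin_factr n i : (i <= n)%N ->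
  'C(n, i)%:R / n`!%:R = (i`!%:R * (n - i)`!%:R)^-1 :> rat.
Proof.
move=> le_in; rewrite -(bin_fact le_in) !natrM.
have c0 : 'C(n, i)%:R != 0 :> rat by rewrite pnatr_eq0 -lt0n bin_gt0.
by field; rewrite c0 !factr_neq0.
Qed.

(** The identity [e^x e^x = e^(2x)] on coefficients. *)
Lemma sum_inv_factr n :
  \sum_(i < n.+1) i`!%:R^-1 * (n - i)`!%:R^-1 = 2%:R ^+ n / n`!%:R :> rat.
Proof.
rewrite -natrX -[2%N]/(1 + 1)%N expnDn natr_sum mulr_suml.
apply: eq_bigr => i _; rewrite !exp1n !muln1 bin_factr ?invfM //.
by rewrite -ltnS.
Qed.

Definition genocchi_egf n : rat :=
  2%:R * (1 - 2%:R ^+ n.+1) * bernoulli n.+1 / n.+1`!%:R.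

(* These are the coefficients of [2 / (e^x + 1)]: with [B(x) = x / (e^x - 1)],
   cancelling [e^x - 1] gives [(e^x + 1) B(2x) = 2 B(x)], so that
   [(e^x + 1) (B(x) - B(2x)) = x]. *)
Lemma genocchi_egf_rec n :
  genocchi_egf n + \sum_(i < n.+1) genocchi_egf i / (n - i)`!%:R
  = 2%:R * (n == 0%N)%:R.
Proof.
(* The coefficient of index [n.+1] is read off at the end, which needs precision [n.+2]; cancelling
   [E - 1] costs one more. [E], [E2], [B], [B2] truncate [e^x], [e^(2x)], [B(x)], [B(2x)]. *)
pose N := n.+3; have nN : (n < N)%N by rewrite /N ltnS leqW // leqW.
pose E : {poly rat} := \poly_(i < N) i`!%:R^-1.
pose E2 : {poly rat} := \poly_(i < N) (2%:R ^+ i / i`!%:R).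
pose B : {poly rat} := \poly_(i < N) (bernoulli i / i`!%:R).
pose B2 : {poly rat} := \poly_(i < N) (2%:R ^+ i * (bernoulli i / i`!%:R)).
have coefE m : (m < N)%N -> (E - 1)`_m = expm1_coef m.
  move=> mN; rewrite coefB coef_poly mN coef1; case: m mN => [|m] mN /=;
    by rewrite ?subr0 // invr1 subrr.
have coefE2 m : (m < N)%N -> (E2 - 1)`_m = 2%:R ^+ m * expm1_coef m.
  move=> mN; rewrite coefB coef_poly mN coef1; case: m mN => [|m] mN /=;
    by rewrite ?subr0 // invr1 mulr1 subrr mulr0.
have lt_sub (m i : nat) : (m < N)%N -> (m - i < N)%N by apply: leq_ltn_trans (leq_subr _ _).
have coefEB m : (m < N)%N -> (B * (E - 1))`_m = (m == 1%N)%:R.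
  move=> mN; rewrite -bernoulli_gf coefM; apply: eq_bigr => i _.
  by rewrite coefE ?lt_sub // coef_poly (leq_trans (ltn_ord i)) // mulrC.
have L1 : low0 N (B * (E - 1) - 'X).
  by move=> m mN; rewrite coefB coefX coefEB // subrr.
have L2 : low0 N (E ^+ 2 - E2).
  move=> m mN; rewrite expr2 coefB coefM coef_poly mN -sum_inv_factr -sumrB big1 // => i _.
  by rewrite !coef_poly (leq_trans (ltn_ord i)) // lt_sub // subrr.
have L3 : low0 N (B2 * (E2 - 1) - 2%:R * 'X).
  move=> m mN; rewrite coefB -polyC_natr coefCM coefX.
  have -> : (B2 * (E2 - 1))`_m = 2%:R ^+ m * (B * (E - 1))`_m.
    rewrite !coefM mulr_sumr; apply: eq_bigr => i _.
    rewrite coefE2 ?lt_sub // coefE ?lt_sub // !coef_poly (leq_trans (ltn_ord i)) //.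
    have -> : 2%:R ^+ m = 2%:R ^+ i * 2%:R ^+ (m - i) :> rat.
      by rewrite -exprD subnKC // -ltnS.
    by ring.
  rewrite coefEB //; case: eqP => [->|_]; rewrite ?mulr0 ?subrr //.
have L4 : low0 n.+2 ((E + 1) * B2 - 2%:R * B).
  apply: (@low0_cancel _ _ (E - 1)); rewrite ?coefE ?invr1 ?oner_eq0 //.
  have -> : (E - 1) * ((E + 1) * B2 - 2%:R * B) =
      B2 * (E ^+ 2 - E2) + ((B2 * (E2 - 1) - 2%:R * 'X)
        + - 2%:R * (B * (E - 1) - 'X)) by ring.
  by apply: low0D; [|apply: low0D => //]; apply: low0Ml.
have L5 : low0 n.+2 ((B - B2) * (E + 1) - 'X).
  have -> : (B - B2) * (E + 1) - 'X =
      (B * (E - 1) - 'X) + - 1 * ((E + 1) * B2 - 2%:R * B) by ring.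
  apply: low0D; last exact: low0Ml.
  by move=> m mn; apply: L1; rewrite ltnS ltnW.
(* The index shift is the division by [x] in [2 (B(x) - B(2x)) / x = 2 / (e^x + 1)]. *)
have coefC m : (m < n.+1)%N -> 2%:R * (B - B2)`_m.+1 = genocchi_egf m.
  move=> mn; rewrite coefB !coef_poly ltnS (leq_trans mn) // /genocchi_egf; ring.
have C0 : (B - B2)`_0 = 0 by rewrite coefB !coef_poly /= mul1r subrr.
have := L5 n.+1 (ltnSn _).
rewrite coefB coefX eqSS mulrDr mulr1 coefD => /eqP; rewrite subr_eq0 => /eqP <-.
rewrite mulrDr coefC // addrC; congr (_ + _).
rewrite coefM [RHS]mulr_sumr [RHS]big_ord_recl C0 mul0r mulr0 add0r.
apply: eq_bigr => i _.
rewrite lift0 mulrA coefC // subSS coef_poly.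
by rewrite (lt_sub _ _ nN).
Qed.

(** * Alternating power sums *)

Definition alt_power_sum p n : rat := \sum_(b < p) (-1) ^+ b * b%:R ^+ n.

(** The exponential generating function of the power sums is the sum of [(-1)^b e^(bx)] over
    [b < p]. Multiplied by [e^x + 1] it telescopes to [1 + e^(px)], as [p] is odd. *)
Lemma alt_power_sum_rec p n : odd p ->
  alt_power_sum p n / n`!%:R
    + \sum_(i < n.+1) alt_power_sum p i / i`!%:R / (n - i)`!%:R
  = ((n == 0%N)%:R + p%:R ^+ n) / n`!%:R.
Proof.
move=> p_odd.
have -> : \sum_(i < n.+1) alt_power_sum p i / i`!%:R / (n - i)`!%:R
        = (\sum_(b < p) (-1) ^+ b * b.+1%:R ^+ n) / n`!%:R.
  under eq_bigr do rewrite /alt_power_sum !mulr_suml.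
  rewrite exchange_big mulr_suml; apply: eq_bigr => b _ /=.
  rewrite -natr1 addrC exprDn mulr_sumr mulr_suml; apply: eq_bigr => i _.
  rewrite expr1n mul1r -(mulrA _ i`!%:R^-1) -invfM -bin_factr -1?ltnS //.
  by rewrite -mulr_natr; ring.
rewrite -mulrDl; congr (_ / _); rewrite /alt_power_sum -big_split /=.
have tele m : \sum_(b < m) ((-1) ^+ b * b%:R ^+ n + (-1) ^+ b * b.+1%:R ^+ n)
    = (n == 0%N)%:R - (-1) ^+ m * m%:R ^+ n :> rat.
  elim: m => [|m IHm]; first by rewrite big_ord0 mul1r expr0n subrr.
  by rewrite big_ord_recr /= IHm exprS; ring.
by rewrite tele -signr_odd p_odd expr1 mulN1r opprK.
Qed.

(** * Congruences modulo [p] *)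

Section BernoulliModP.

Variable p : nat.
Hypotheses (p_prime : prime p) (p_odd : odd p).

Lemma fact_Zloc n : (n < p)%N -> n`!%:R^-1 \in Zloc p.
Proof.
move=> np; apply: Zloc_invn; rewrite coprime_sym prime_coprime //.
elim: n np => [|n IHn] np; first by rewrite dvdn1 neq_ltn prime_gt1 ?orbT.
by rewrite factS Euclid_dvdM // negb_or gtnNdvd // IHn // ltnW.
Qed.

(** The recurrence for [bernoulli n] divides only by factorials up to [n.+1], all prime to [p]. *)
Lemma bernoulli_Zloc n : (n.+1 < p)%N -> bernoulli n / n`!%:R \in Zloc p.
Proof.
elim/ltn_ind: n => n IHn np; have := bernoulli_gf n.+1.
rewrite big_ord_recr /= subnn mul0r addr0 big_ord_recr /= subSnn /= mul1r.
move=> h.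
have -> : bernoulli n / n`!%:R = (n == 0%N)%:R
   - \sum_(i < n) expm1_coef (n.+1 - i) * (bernoulli i / i`!%:R).
  by rewrite -eqSS -h addrAC subrr add0r.
rewrite rpredB ?rpred_nat // rpred_sum // => i _.
apply: rpredM; last by apply: IHn; rewrite // (leq_ltn_trans (ltn_ord i)) // ltnW.
have -> : expm1_coef (n.+1 - i) = (n.+1 - i)`!%:R^-1 by rewrite subSn 1?ltnW.
by apply: fact_Zloc; rewrite (leq_ltn_trans _ np) // leq_subr.
Qed.

(** Both sequences satisfy the same recurrence up to the error [p ^ n / n!] for [n > 0], and exactly
    at [n = 0]. This error is divisible by [p], and [2] is invertible, so strong induction
    applies. *)
Lemma alt_power_sum_genocchi n : (n < p)%N ->
  (alt_power_sum p n / n`!%:R - genocchi_egf n) / p%:R \in Zloc p.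
Proof.
have p0 : p%:R != 0 :> rat by rewrite pnatr_eq0 -lt0n prime_gt0.
pose d n := alt_power_sum p n / n`!%:R - genocchi_egf n.
rewrite -/(d n); elim/ltn_ind: n => n IHn np.
have rec : d n + \sum_(i < n.+1) d i / (n - i)`!%:R
    = ((n == 0%N)%:R + p%:R ^+ n) / n`!%:R - 2%:R * (n == 0%N)%:R.
  rewrite -alt_power_sum_rec // -genocchi_egf_rec /d.
  under eq_bigr do rewrite mulrBl.
  by rewrite sumrB; ring.
have c2 : 2%:R^-1 \in Zloc p by rewrite Zloc_invn // coprime2n.
rewrite big_ord_recr /= subnn divr1 in rec.
(* The right-hand side of [rec] divided by [p]. *)
pose e : rat := if n is m.+1 then p%:R ^+ m / n`!%:R else 0.
have -> : d n / p%:R =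
    2%:R^-1 * (e - \sum_(i < n) (d i / p%:R) * (n - i)`!%:R^-1).
  have -> : \sum_(i < n) (d i / p%:R) * (n - i)`!%:R^-1
      = (\sum_(i < n) d i / (n - i)`!%:R) / p%:R.
    by rewrite mulr_suml; apply: eq_bigr => i _; rewrite mulrAC.
  have -> : e = (((n == 0%N)%:R + p%:R ^+ n) / n`!%:R - 2%:R * (n == 0%N)%:R) / p%:R.
    rewrite /e; case: (n) => [|m] /=; first by rewrite fact0; field.
    by rewrite mulr0 subr0 add0r exprS; field; rewrite p0 factr_neq0.
  by rewrite -rec; field.
rewrite rpredM // rpredB //.
  rewrite /e; case: (n) np => [|m] np; rewrite ?rpred0 //.
  by rewrite rpredM ?fact_Zloc // rpredX // rpred_nat.
apply: rpred_sum => i _; rewrite rpredM ?IHn ?(ltn_trans _ np) //.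
by rewrite fact_Zloc // (leq_ltn_trans _ np) // leq_subr.
Qed.

Lemma fermat_Zloc b : coprime b p -> (b%:R ^+ p.-1 - 1) / p%:R \in Zloc p.
Proof.
move=> bp; have b_gt0 : (0 < b)%N.
  by rewrite lt0n; case: eqP bp => // ->; rewrite /coprime gcd0n gtn_eqF // prime_gt1.
have b0 : (0 < b ^ p.-1)%N by rewrite expn_gt0 b_gt0.
have: (p %| b ^ p.-1 - 1)%N.
  rewrite -(@Gauss_dvdr _ b); last by rewrite coprime_sym.
  rewrite mulnBr muln1 -expnS prednK ?prime_gt0 //.
  rewrite -eqn_mod_dvd; first by rewrite fermat_little.
  exact: (@leq_pexp2l b 1 p b_gt0 (prime_gt0 p_prime)).
case/dvdnP=> k hk; have p0 : p%:R != 0 :> rat by rewrite pnatr_eq0 -lt0n prime_gt0.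
by rewrite -natrX -(natrB _ b0) hk natrM mulfK // rpred_nat.
Qed.

(* For [p > 3] the exponent [-3] may be replaced by [p - 4]. *)
Lemma alt_inv_cubes_bernoulli :
  (alt_inv_cubes p + bernoulli (p - 3) / 2%:R) / p%:R \in Zloc p.
Proof.
have p0 : p%:R != 0 :> rat by rewrite pnatr_eq0 -lt0n prime_gt0.
(* For [p = 3] the exponent [p - 4] would be negative; there the quotient is
   [(-7/8 + 1/2) / 3 = -1/8]. *)
have [p_le4|p_gt4] := leqP p 4.
  have -> : p = 3%N by move: (prime_gt1 p_prime) p_odd p_le4; case: (p) => [|[|[|[|[|]]]]].
  have -> : (alt_inv_cubes 3 + bernoulli (3 - 3) / 2%:R) / 3%:R = - 8%:R^-1.
    rewrite /alt_inv_cubes !big_ord_recl big_ord0 /bernoulli /= big_ord0 /=.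
    by rewrite expr0n invr0 mulr0 subnn fact0 /bump !add1n; field.
  by rewrite rpredN Zloc_invn.
set n := (p - 4)%N; have np : (n < p)%N by rewrite /n; lia.
have -> : (p - 3)%N = n.+1 by rewrite /n; lia.
have ep : p = n.+4 by rewrite /n; lia.
have n_gt0 : (0 < n)%N by rewrite subn_gt0.
clearbody n.
have n1 : n.+1%:R != 0 :> rat by rewrite pnatr_eq0.
(* Three corrections: Fermat for the inverse cubes, the comparison of power sums with
   [genocchi_egf], and the constant. For the last, [2 ^ n.+1 = 2 ^ p.-1 / 4] is [1/4] and
   [n.+1 = p - 3] is [-3] modulo [p], so [2 (1 - 2 ^ n.+1) / n.+1] is [-1/2]. *)
have -> : (alt_inv_cubes p + bernoulli n.+1 / 2%:R) / p%:R =
    (alt_inv_cubes p - alt_power_sum p n) / p%:R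
    + n`!%:R * ((alt_power_sum p n / n`!%:R - genocchi_egf n) / p%:R)
    + bernoulli n.+1 / n.+1`!%:R * n`!%:R * 2%:R^-1
       * (1 - (2%:R ^+ p.-1 - 1) / p%:R).
  rewrite /genocchi_egf factS natrM ep /= !exprS.
  have -> : n.+4%:R = n.+1%:R + 3%:R :> rat by rewrite -natrD addn3.
  have p0' : n.+1%:R + 3%:R != 0 :> rat by rewrite -natrD addn3 -ep.
  move: n1 p0' (factr_neq0 n); move: (n.+1%:R : rat) (n`!%:R : rat) => u v u0 w0 v0.
  by field; rewrite u0 w0 v0.
have c2 : 2%:R^-1 \in Zloc p by rewrite Zloc_invn // coprime2n.
rewrite !rpredD //.
- rewrite /alt_inv_cubes /alt_power_sum -sumrB mulr_suml rpred_sum // => b _.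
  case: (posnP b) => [->|b_gt0].
    by rewrite !expr0n invr0 (gtn_eqF n_gt0) !mulr0 subrr mul0r rpred0.
  have bp : coprime b p by apply: coprime_ltn => //; rewrite b_gt0 /=.
  have b0 : b%:R != 0 :> rat by rewrite pnatr_eq0 -lt0n.
  have -> : ((-1) ^+ b / b%:R ^+ 3 - (-1) ^+ b * b%:R ^+ n) / p%:R =
      - ((-1) ^+ b / b%:R ^+ 3 * ((b%:R ^+ p.-1 - 1) / p%:R)) :> rat.
    have -> : p.-1 = (n + 3)%N by rewrite ep addn3.
    by rewrite exprD; field; rewrite p0.
  by rewrite rpredN rpredM ?fermat_Zloc ?inv_cube_Zloc.
- by rewrite rpredM ?rpred_nat ?alt_power_sum_genocchi.
- have bn : bernoulli n.+1 / n.+1`!%:R \in Zloc p.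
    by apply: bernoulli_Zloc; rewrite ep.
  apply: rpredM; last by rewrite rpredB ?rpred1 ?fermat_Zloc ?coprime2n.
  by apply: rpredM => //; apply: rpredM => //; apply: rpred_nat.
Qed.

End BernoulliModP.

Theorem theorem1 (p r : nat) (p_prime : prime p) (p_ge3 : (3 <= p)%N)
    (r_gt0 : (0 < r)%N) :
  congr_mod p r
    (\sum_(i < (p ^ r).+1) \sum_(j < (p ^ r).+1)
       \sum_(k < (p ^ r).+1 | [&& prime_to p i, prime_to p j, prime_to p k
                                & (i + j + k == p ^ r)%N])
         (-1) ^+ i / (i%:R * j%:R * k%:R))
    (p%:R ^+ r.-1 / 2%:R * bernoulli (p - 3)).
Proof.
have p_odd : odd p by case: (even_prime p_prime) p_ge3 => // ->.
apply: (congr_mod_trans (triple_sum_congr p_prime p_odd r_gt0)).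
have p0 : p%:R != 0 :> rat by rewrite pnatr_eq0 -lt0n prime_gt0.
rewrite /congr_mod; set a := alt_inv_cubes p; set b := bernoulli _.
(* The common factor [p ^ r.-1] cancels, leaving the congruence modulo [p] for the inverse cubes. *)
have -> : (- (p%:R ^+ r.-1 * a) - p%:R ^+ r.-1 / 2%:R * b) / p%:R ^+ r
    = - ((a + b / 2%:R) / p%:R).
  have -> : p%:R ^+ r = p%:R * p%:R ^+ r.-1 :> rat.
    by rewrite -exprS prednK.
  by field; rewrite p0 expf_neq0.
have : - ((a + b / 2%:R) / p%:R) \in Zloc p by rewrite rpredN alt_inv_cubes_bernoulli.
by rewrite inE.
Qed.
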